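(* Let $P$ be a parallelogram and $T$ a triangle in the Euclidean plane $E^2$. Then $\delta_{BM}^{\rm cen}(P,T)=\frac{5}{2}$.
   Context: For convex bodies $C,D\subset E^d$, the centroid Banach–Mazur distance is $$\delta_{BM}^{\rm cen}(C,D)=\inf_{a,\,h_\lambda}\{\lambda:\ a(D)\subset C\subset h_\lambda(a(D))\ \text{and}\ {\rm cen}(a(D))={\rm cen}(C)\},$$ where $a$ ranges over (non-degenerate) affine transformations of $E^d$, ${\rm cen}(X)$ denotes the centroid (center of mass) of $X$, and $h_\lambda$ is the homothety with ratio $\lambda\ge 1$ whose center is the common centroid ${\rm cen}(a(D))={\rm cen}(C)$. *)

(* Defs.v *)
From HB Require Import structures.
From mathcomp Require Import all_boot all_order all_algebra.
From mathcomp Require Import all_classical all_reals all_analysis.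
Set Implicit Arguments. Unset Strict Implicit. Unset Printing Implicit Defensive.
Import Order.TTheory GRing.Theory Num.Theory.
Local Open Scope classical_set_scope.
Local Open Scope ring_scope.

Section Defs.
Variable R : realType.

Definition leb2 : set (R * R) -> \bar R :=
  ((@lebesgue_measure R) \x (@lebesgue_measure R))%E.

Definition area (X : set (R * R)) : R := fine (leb2 X).

Definition centroid (X : set (R * R)) : R * R :=
  (fine (\int[leb2]_(x in X) (x.1)%:E)%E / area X,
   fine (\int[leb2]_(x in X) (x.2)%:E)%E / area X).

Definition nondeg_affine (f : R * R -> R * R) : Prop :=
  exists a b c d e g : R, a * d - b * c != 0 /\
    forall x : R * R, f x = (a * x.1 + b * x.2 + e, c * x.1 + d * x.2 + g).

Definition homothety (z : R * R) (l : R) (x : R * R) : R * R :=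
  (z.1 + l * (x.1 - z.1), z.2 + l * (x.2 - z.2)).

Definition parallelogram (P : set (R * R)) : Prop :=
  exists p u v : R * R, u.1 * v.2 - u.2 * v.1 != 0 /\
    P = [set x | exists s t : R, [/\ 0 <= s <= 1, 0 <= t <= 1 &
             x = (p.1 + s * u.1 + t * v.1, p.2 + s * u.2 + t * v.2)]].

Definition triangle (T : set (R * R)) : Prop :=
  exists p u v : R * R, u.1 * v.2 - u.2 * v.1 != 0 /\
    T = [set x | exists s t : R, [/\ 0 <= s, 0 <= t, s + t <= 1 &
             x = (p.1 + s * u.1 + t * v.1, p.2 + s * u.2 + t * v.2)]].

Definition cenBM (C D : set (R * R)) : R :=
  inf [set l : R | 1 <= l /\ exists f : R * R -> R * R,
        [/\ nondeg_affine f,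
            f @` D `<=` C,
            C `<=` homothety (centroid (f @` D)) l @` (f @` D) &
            centroid (f @` D) = centroid C]].

End Defs.

(* Main.v *)
Require Import Defs.
From HB Require Import structures.
From mathcomp Require Import all_boot all_order all_algebra.
From mathcomp Require Import all_classical all_reals all_analysis.
From mathcomp Require Import measurable_realfun ring lra.
Set Implicit Arguments.
Unset Strict Implicit.
Unset Printing Implicit Defensive.
Import Order.TTheory GRing.Theory Num.Theory.
Local Open Scope classical_set_scope.
Local Open Scope ring_scope.

(* An invertible affine map multiplies areas by a constant, so it commutes with
   centroids. Hence the centroids of the simplex [0 <= s, t; s + t <= 1] and of
   the square [-1, 1]^2 are the fixed points of affine symmetries, and we may
   take P to be the square, with centroid 0. A triangle ABC in the square with
   A + B + C = 0 has area 3/2 |A x B|, and the square lies in its l-fold dilation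
   iff l |A x B| is at least the l^1 norm of every edge. The claim thus becomes:
   some edge has l^1 norm at least 5/2 |A x B|, with equality for some
   nondegenerate triangle. *)

(** * Affine maps and the Lebesgue measure of the plane *)

Section AffineMeasure.
Variable R : realType.
Notation M := (measurableTypeR R).
Notation leb := (@lebesgue_measure R).

(** Bundles the pushforward as a measure behind an existential, so that uniqueness theorems for
    measures apply to it. *)
Lemma pushforward_measureP d1 d2 (T1 : measurableType d1)
    (T2 : measurableType d2) (m : {measure set T1 -> \bar R}) (f : T1 -> T2) :
  measurable_fun [set: T1] f ->
  exists nu : {measure set T2 -> \bar R}, forall A, nu A = m (f @^-1` A).
Proof.
move=> mf; suff [nu nuE] : exists nu : {measure set T2 -> \bar R},
  pushforward m f = nu by exists nu => A; rewrite -nuE.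
by unshelve (eexists; reflexivity).
Qed.

Lemma measurable_affine1 (a b : R) :
  measurable_fun [set: M] ((fun y : R => a * y + b) : M -> M).
Proof.
by apply: measurable_funD => //; apply: measurable_funM.
Qed.

(** By uniqueness of Lebesgue measure, it is enough that [|a|] times the pushforward gives every
    interval []u, v]] its length. *)
Lemma lebesgue_measure_affine (a b : R) (B : set M) : a != 0 -> measurable B ->
  leb ((fun y : R => a * y + b) @^-1` B) = ((`|a|^-1)%:E * leb B)%E.
Proof.
move=> a0 mB.
pose f (y : R) : R := a * y + b.
have mf : measurable_fun [set: M] (f : M -> M) := measurable_affine1 a b.
have aK : `|a| != 0 by rewrite normr_eq0.
have [nu nuE] := pushforward_measureP leb mf.
suff -> : leb B = mscale (NngNum (normr_ge0 a)) nu B.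
  by rewrite /mscale /= nuE muleA -EFinM mulVf// mul1e.
apply: lebesgue_measure_unique => // _ [[u v]] _ <-.
rewrite [RHS]/= /mscale [_%:num]/= nuE.
have preE (i : interval R) : f @^-1` `]u, v] = [set` i] :> set R ->
    leb (f @^-1` `]u, v]) = (if i.1 < i.2 then (i.2 : \bar R) - i.1 else 0)%E.
  by move=> ->; exact: lebesgue_measure_itv.
rewrite lebesgue_measure_itv /= lte_fin.
have [agt0|alt0|a00] := ltgtP 0 a; last by rewrite -a00 eqxx in a0.
  rewrite (preE `](u - b) / a, (v - b) / a]); last first.
    apply/seteqP; split => y /=; rewrite !in_itv /= /f ltr_pdivrMr//
      ler_pdivlMr//; lra.
  rewrite /= lte_fin ltr_pM2r ?invr_gt0// ltrD2r.
  case: ifPn => _; last by rewrite mule0.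
  rewrite -!EFinB -EFinM gtr0_norm//; congr EFin; field; exact: a0.
(* For [a < 0] the map reverses order, so the preimage is closed on the left and open on the
   right. *)
rewrite (preE `[(v - b) / a, (u - b) / a[); last first.
  apply/seteqP; split => y /=; rewrite !in_itv /= /f ler_ndivrMr//
    ltr_ndivlMr//; lra.
rewrite /= lte_fin ltr_nM2r ?invr_lt0// ltrD2r.
case: ifPn => _; last by rewrite mule0.
rewrite -!EFinB -EFinM ltr0_norm//; congr EFin; field; exact: a0.
Qed.

(** Stated with preimages: [f] pushes area forward to [c] times area, and such maps compose at
    once. *)
Definition scales_leb2 (f : R * R -> R * R) : Prop :=
  measurable_fun [set: M * M] (f : M * M -> M * M) /\
  exists2 c : R, 0 < c & forall A : set (M * M), measurable A ->
    leb2 (f @^-1` A) = (c%:E * leb2 A)%E.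

Lemma scales_leb2_comp f g :
  scales_leb2 f -> scales_leb2 g -> scales_leb2 (f \o g).
Proof.
move=> [mf [c c0 fc]] [mg [d d0 gd]]; split; first exact: measurableT_comp.
exists (d * c); first exact: mulr_gt0.
move=> A mA; rewrite comp_preimage gd; first by rewrite fc// muleA EFinM.
by rewrite -[X in measurable X]setTI; exact: mf.
Qed.

(** A measure with the right values on rectangles is the product measure, and the swap preserves the
    area of rectangles. *)
Lemma scales_leb2_swap : scales_leb2 (fun x => (x.2, x.1)).
Proof.
have ms : measurable_fun [set: M * M] ((fun x => (x.2, x.1)) : M * M -> M * M).
  by apply: measurable_fun_pair; [exact: measurable_snd|exact: measurable_fst].
split=> //; exists 1 => // A mA; rewrite mul1e.
have [nu nuE] := pushforward_measureP (leb \x leb)%E ms.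
suff -> : leb2 A = nu A by rewrite nuE.
apply: product_measure_unique => // X Y mX mY; rewrite nuE.
have sE : (fun x : M * M => (x.2, x.1)) @^-1` (X `*` Y) = Y `*` X.
  by apply/seteqP; split => -[x y] /= [].
by rewrite sE muleC; exact: product_measure1E.
Qed.

(** Cavalieri's principle: on each vertical line the map is affine of slope [a], so every section
    scales by the same factor. *)
Lemma scales_leb2_shear (a b e : R) : a != 0 ->
  scales_leb2 (fun x => (x.1, a * x.2 + b * x.1 + e)).
Proof.
move=> a0.
have mf : measurable_fun [set: M * M]
    ((fun x => (x.1, a * x.2 + b * x.1 + e)) : M * M -> M * M).
  apply: measurable_fun_pair; first exact: measurable_fst.
  apply: measurable_funD => //.
  by apply: measurable_funD; apply: measurable_funM.
split=> //; exists (`|a|^-1); first by rewrite invr_gt0 normr_gt0.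
move=> A mA; rewrite /leb2 /product_measure1.
rewrite -ge0_integralZl//; last exact: measurable_fun_xsection.
apply: eq_integral => x _ /=.
rewrite -(@lebesgue_measure_affine a (b * x + e))//; last exact: measurable_xsection.
congr lebesgue_measure; apply/seteqP; split => y;
  by rewrite /xsection /= !inE /= addrA.
Qed.

(** Gaussian elimination: for [a != 0] the map factors into two shears and two swaps. If [a = 0]
    then [b != 0], and precomposing with the swap exchanges the columns. *)
Lemma scales_leb2_affine f : nondeg_affine f -> scales_leb2 f.
Proof.
pose sw := fun x : R * R => (x.2, x.1).
have sw_s : scales_leb2 sw by exact: scales_leb2_swap.
have base a b c d e g : a != 0 -> a * d - b * c != 0 ->
    scales_leb2 (fun x => (a * x.1 + b * x.2 + e, c * x.1 + d * x.2 + g)).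
  move=> a0 D0.
  pose h1 (x : R * R) := (x.1, a * x.2 + b * x.1 + e).
  pose h2 (x : R * R) :=
    (x.1, (a * d - b * c) / a * x.2 + c / a * x.1 + (g - c / a * e)).
  have h1s : scales_leb2 h1 by exact: scales_leb2_shear.
  have h2s : scales_leb2 h2.
    by apply: scales_leb2_shear; rewrite mulf_neq0 ?invr_eq0.
  rewrite (_ : (fun x => _) = h2 \o (sw \o (h1 \o sw))).
    by do ![apply: scales_leb2_comp => //].
  apply/funext => -[x y]; rewrite /h2 /h1 /=; congr pair; field; exact: a0.
move=> [a [b [c [d [e [g [D0 fE]]]]]]].
have {fE} -> : f = fun x => (a * x.1 + b * x.2 + e, c * x.1 + d * x.2 + g).
  exact/funext.
have [a0|a0] := eqVneq a 0; last exact: base.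
have b0 : b != 0 by apply: contra_neq D0 => ->; rewrite a0; ring.
have /(base b a d c e g b0) fs : b * c - a * d != 0.
  by rewrite -opprB oppr_eq0.
rewrite (_ : (fun x => _) =
    (fun x => (b * x.1 + a * x.2 + e, d * x.1 + c * x.2 + g)) \o sw).
  exact: scales_leb2_comp.
by apply/funext => -[x y] /=; congr pair; ring.
Qed.

End AffineMeasure.

(** * Centroids *)

Section Centroid.
Variable R : realType.
Notation M := (measurableTypeR R).
Notation leb := (@lebesgue_measure R).
Notation mu := ((leb \x leb)%E).

(** Change of variables: the pushforward of [mu] by [f] agrees with [c] times [mu] on measurable
    sets. *)
Lemma ge0_integral_scales (f : M * M -> M * M) (c : R) (Y : set (M * M))
    (h : M * M -> \bar R) :
  measurable_fun setT f -> 0 <= c ->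
  (forall A : set (M * M), measurable A -> mu (f @^-1` A) = (c%:E * mu A)%E) ->
  measurable Y -> measurable_fun setT h -> (forall y, 0 <= h y)%E ->
  (\int[mu]_(x in f @^-1` Y) h (f x) = c%:E * \int[mu]_(y in Y) h y)%E.
Proof.
move=> mf c0 fc mY mh h0.
have [nu nuE] := pushforward_measureP mu mf.
have nuf : (nu : set (M * M) -> \bar R) = pushforward mu f.
  by apply/funext => A; rewrite nuE.
have mhY : measurable_fun Y h by exact: measurable_funTS.
rewrite -(@ge0_integral_pushforward _ _ _ _ _ f mf mu Y h mY mhY); last first.
  by move=> y _; exact: h0.
rewrite -nuf.
have -> : (\int[nu]_(y in Y) h y =
           \int[mscale (NngNum c0) mu]_(y in Y) h y)%E.
  by apply: eq_measure_integral => A mA _; rewrite nuE; exact: fc.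
by rewrite ge0_integral_mscale.
Qed.

Lemma integral_scales (f : M * M -> M * M) (c : R) (Y : set (M * M))
    (h : M * M -> \bar R) :
  measurable_fun setT f -> 0 <= c ->
  (forall A : set (M * M), measurable A -> mu (f @^-1` A) = (c%:E * mu A)%E) ->
  measurable Y -> measurable_fun setT h -> integrable mu Y h ->
  (\int[mu]_(x in f @^-1` Y) h (f x) = c%:E * \int[mu]_(y in Y) h y)%E.
Proof.
move=> mf c0 fc mY mh ih.
have p := integrable_funepos mY ih; have n := integrable_funeneg mY ih.
rewrite (integralE _ _ h) muleBr//; last first.
  by rewrite fin_num_adde_defl// fin_numN integrable_fin_num.
rewrite (integralE _ _ (fun x => h (f x))).
rewrite -(ge0_integral_scales mf c0 fc mY (measurable_funepos mh))//.
rewrite -(ge0_integral_scales mf c0 fc mY (measurable_funeneg mh))//.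
have -> : (fun x => h (f x)) = h \o f by [].
by rewrite funepos_comp funeneg_comp.
Qed.

Definition square (K : R) : set (M * M) := `[- K, K]%classic `*` `[- K, K]%classic.

(** Boundedness makes the area finite and the coordinates integrable; positive area makes the
    divisions in [centroid] meaningful. *)
Definition body (X : set (M * M)) : Prop :=
  [/\ measurable X, exists K : R, X `<=` square K & (0 < mu X)%E].

Lemma body_finite X : body X -> (mu X < +oo)%E.
Proof.
move=> [mX [K XK] _].
apply: (@le_lt_trans _ _ (mu (square K))).
  apply: le_measure => //; rewrite inE//.
  by apply: measurableX; exact: measurable_itv.
have Kfin : leb (`[- K, K]%classic : set R) \is a fin_num.
  by rewrite lebesgue_measure_itv /=; case: ifPn.
rewrite product_measure1E; [|exact: measurable_itv..].
by rewrite ltey_eq fin_numM.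
Qed.

Lemma body_area X : body X -> 0 < area X.
Proof.
by move=> bX; have := body_finite bX; case: bX => _ _ X0 Xoo; rewrite fine_gt0// X0.
Qed.

Lemma body_integrable X (h : M * M -> R) (C : R) : body X ->
  measurable_fun [set: M * M] h -> (forall x, X x -> `|h x| <= C) ->
  integrable mu X (EFin \o h).
Proof.
move=> bX mh hC; apply: measurable_bounded_integrable.
- by case: bX.
- exact: body_finite.
- exact: measurable_funTS.
- exists C; split; first exact: num_real.
  by move=> y Cy x Xx; apply: le_trans (ltW Cy); exact: hC.
Qed.

Lemma body_integrable1 X : body X -> integrable mu X (EFin \o fst).
Proof.
move=> bX; have [_ [K XK] _] := bX.
apply: (body_integrable (C := K)) => //.
by move=> x /XK [] /=; rewrite !in_itv /= ler_norml.
Qed.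

Lemma body_integrable2 X : body X -> integrable mu X (EFin \o snd).
Proof.
move=> bX; have [_ [K XK] _] := bX.
apply: (body_integrable (C := K)) => //.
by move=> x /XK [_] /=; rewrite !in_itv /= ler_norml.
Qed.

(** Cramer's rule; the inverse has determinant [D^-1]. *)
Lemma nondeg_affine_inv (f : R * R -> R * R) : nondeg_affine f ->
  exists2 g : R * R -> R * R, nondeg_affine g & cancel f g /\ cancel g f.
Proof.
move=> [a [b [c [d [e [g [D0 fE]]]]]]].
pose D := a * d - b * c.
exists (fun x => (d / D * x.1 + - b / D * x.2 + (b * g - d * e) / D,
                  - c / D * x.1 + a / D * x.2 + (c * e - a * g) / D)).
  exists (d / D), (- b / D), (- c / D), (a / D),
    ((b * g - d * e) / D), ((c * e - a * g) / D); split=> //.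
  have -> : d / D * (a / D) - - b / D * (- c / D) = D^-1.
    by rewrite /D; field.
  by rewrite invr_eq0.
by split=> -[x y]; rewrite !fE /=; congr pair; rewrite /D; field.
Qed.

(** Turns images into preimages under the inverse, the form in which the scaling of area is
    available. *)
Lemma image_cancel (f g : R * R -> R * R) (X : set (R * R)) :
  cancel f g -> cancel g f -> f @` X = g @^-1` X.
Proof.
move=> fK gK; apply/seteqP; split => [_ [x Xx <-]|x Xgx] /=.
  by rewrite fK.
by exists (g x).
Qed.

Lemma body_image (f : R * R -> R * R) X :
  nondeg_affine f -> body X -> body (f @` X).
Proof.
move=> af [mX [K XK] X0].
have [g ag [fK gK]] := nondeg_affine_inv af.
have [mg [c c0 gc]] := scales_leb2_affine ag.
rewrite (image_cancel X fK gK); split.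
- by rewrite -[X in measurable X]setTI; exact: mg.
- have [a [b [k [d [e [l [_ fE]]]]]]] := af.
  (* One bound for both coordinates: the sum of the bounds for each of them. *)
  exists (`|a| * K + `|b| * K + `|k| * K + `|d| * K + `|e| + `|l|).
  move=> x /= /XK; set y := g x => -[].
  rewrite /= !in_itv /= -!ler_norml => y1 y2.
  have -> : x = f y by rewrite /y gK.
  have K0 : 0 <= K by apply: le_trans y1.
  have H (u v : R) : `|v| <= K -> `|u * v| <= `|u| * K.
    by move=> vK; rewrite normrM ler_wpM2l.
  rewrite fE; split; rewrite /= in_itv /= -ler_norml.
    apply: (le_trans (ler_normD _ _)); apply: (le_trans (lerD (ler_normD _ _) (lexx _))).
    have := H a _ y1; have := H b _ y2.
    have := mulr_ge0 (normr_ge0 k) K0; have := mulr_ge0 (normr_ge0 d) K0.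
    have := normr_ge0 l; lra.
  apply: (le_trans (ler_normD _ _)); apply: (le_trans (lerD (ler_normD _ _) (lexx _))).
  have := H k _ y1; have := H d _ y2.
  have := mulr_ge0 (normr_ge0 a) K0; have := mulr_ge0 (normr_ge0 b) K0.
  have := normr_ge0 e; lra.
- by move: (gc _ mX); rewrite /leb2 => ->; rewrite mule_gt0// lte_fin.
Qed.

(* [R * R] and [M * M] have the same measurable sets but are distinct
   measurable types: [leb2] is the pushforward of [mu] by the identity. *)
Lemma integral_leb2 (X : set (R * R)) (h : R * R -> \bar R) :
  measurable X -> measurable_fun [set: R * R] h -> integrable mu X h ->
  (\int[@leb2 R]_(x in X) h x = \int[mu]_(x in X) h x)%E.
Proof.
move=> mX mh ih.
have mid : measurable_fun [set: M * M] (idfun : M * M -> (R * R)%type).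
  by move=> _ Y mY; rewrite setTI; exact: mY.
exact: (@integral_pushforward _ _ _ _ _ _ mid mu X h mh ih mX).
Qed.

Lemma centroidE X : body X ->
  centroid X = (\int[mu]_(x in X) x.1 / area X, \int[mu]_(x in X) x.2 / area X).
Proof.
move=> bX; have mX : measurable X by case: bX.
rewrite /centroid /Rintegral.
rewrite (@integral_leb2 X (fun x => (x.1)%:E) mX _ (body_integrable1 bX)).
  rewrite (@integral_leb2 X (fun x => (x.2)%:E) mX _ (body_integrable2 bX))//.
  by apply/measurable_EFinP; exact: measurable_snd.
by apply/measurable_EFinP; exact: measurable_fst.
Qed.

(** The factor [c] occurs both in the area and in the integrals, so averages over [Y] are averages
    over [X] of the composite with [f] ([key]); linearity of the integral ([lin]) does the rest. *)
Lemma centroid_affine (f : R * R -> R * R) X :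
  nondeg_affine f -> body X -> centroid (f @` X) = f (centroid X).
Proof.
move=> af bX; have bY := body_image af bX.
have [mf [c c0 fc]] := scales_leb2_affine af.
have [g _ [fK gK]] := nondeg_affine_inv af.
set Y := f @` X in bY *.
have XE : X = f @^-1` Y by rewrite /Y (image_cancel X fK gK); apply/seteqP;
  split => x /=; rewrite fK.
have mX : measurable X by case: bX.
have mY : measurable Y by case: bY.
have aX := body_area bX; have aY := body_area bY.
have aE : area X = c * area Y.
  rewrite {1}XE /area fc// fineM// ge0_fin_numE ?(body_finite bY)//.
have i1 := body_integrable1 bX; have i2 := body_integrable2 bX.
have key (h : M * M -> R) : measurable_fun setT h -> integrable mu Y (EFin \o h) ->
    \int[mu]_(y in Y) h y / area Y = \int[mu]_(x in X) h (f x) / area X.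
  move=> mh ih; rewrite aE.
  have -> : \int[mu]_(x in X) h (f x) = c * \int[mu]_(y in Y) h y.
    rewrite /Rintegral {1}XE.
    rewrite (@integral_scales f c Y (EFin \o h) mf (ltW c0) fc mY _ ih)//.
      by rewrite fineM// integrable_fin_num.
    exact/measurable_EFinP.
  by field; rewrite !gt_eqF.
have iZ (w : R) (h : M * M -> R) : integrable mu X (EFin \o h) ->
    integrable mu X (EFin \o (fun x => w * h x)).
  by move=> ih; exact: (integrableZl mX w ih).
have lin (u v w : R) : \int[mu]_(x in X) (u * x.1 + v * x.2 + w) =
    u * \int[mu]_(x in X) x.1 + v * \int[mu]_(x in X) x.2 + w * area X.
  rewrite RintegralD//; last 2 first.
  - exact: (integrableD mX (iZ u _ i1) (iZ v _ i2)).
  - by apply: (body_integrable (C := `|w|)).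
  rewrite RintegralD//; [|exact: iZ..].
  by rewrite !RintegralZl// Rintegral_cst.
have [a [b [k [d [e [l [_ fE]]]]]]] := af.
rewrite (centroidE bX) (centroidE bY) fE /=; congr pair.
  rewrite (key fst measurable_fst (body_integrable1 bY)).
  under eq_Rintegral do rewrite fE /=.
  by rewrite lin; field; rewrite gt_eqF.
rewrite (key snd measurable_snd (body_integrable2 bY)).
under eq_Rintegral do rewrite fE /=.
by rewrite lin; field; rewrite gt_eqF.
Qed.

End Centroid.

(** * Triangles in the square with centroid at the origin *)

Section LowerBound.
Variable R : realType.
Implicit Types x y a b c p q M : R.

Lemma add_norm_le x y M : `|x| + `|y| <= M ->
  [/\ x + y <= M, x - y <= M, - x + y <= M & - x - y <= M].
Proof.
move=> H; have := ler_norm x; have := ler_norm y.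
have := ler_norm (- x); have := ler_norm (- y); rewrite !normrN.
by split; lra.
Qed.

(** The case of vertices A = (-1, q), B = (b, -1), C = (1 - b, 1 - q), where [1 - b * q] is A x B.
    The three left sides bound from below the l^1 norms of A - B, C - A and B - C. *)
Lemma normalized_bound b q M : 0 <= b -> 0 <= q ->
  2 + b + q <= M -> 3 - b - 2 * q <= M -> 3 - 2 * b - q <= M ->
  5 / 2 * (1 - b * q) <= M.
Proof.
move=> b0 q0 h1 h2 h3; rewrite leNgt; apply/negP => h.
(* If the claim fails, the first bound combined with the second gives [qb], and with the third gives
   [bq]. Hence [b] and [q] are positive and below 1/5, too small for [h2]. *)
have qb : 5 * (b * q) < q by lra.
have bq : 5 * (b * q) < b by lra.
have b5 : b < 1 / 5 by nra.
have q5 : q < 1 / 5 by nra.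
have : b * (1 - 5 / 2 * q) < 1 / 5 * (1 - 5 / 2 * q) by rewrite ltr_pM2r; lra.
nra.
Qed.

Definition balanced (A B C : R * R) M : Prop :=
  [/\ A.1 + B.1 + C.1 = 0 /\ A.2 + B.2 + C.2 = 0,
      [/\ `|A.1| <= 1, `|B.1| <= 1 & `|C.1| <= 1],
      [/\ `|A.2| <= 1, `|B.2| <= 1 & `|C.2| <= 1] &
      [/\ `|A.1 - B.1| + `|A.2 - B.2| <= M,
          `|B.1 - C.1| + `|B.2 - C.2| <= M &
          `|C.1 - A.1| + `|C.2 - A.2| <= M]].

Definition cross (A B : R * R) : R := A.1 * B.2 - A.2 * B.1.

(** Among three numbers with sum 0, one has sign opposite to the other two; here it is the first, on
    the negative side. *)
Definition pointing (x1 x2 x3 : R) := [/\ x1 <= 0, 0 <= x2 & 0 <= x3].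

(** Here A x B = B x C is a difference of two nonnegative products, so each product is bounded
    separately. Half the sum of the two edges at A gives 3/2 (x2 + x3 + y2 + y3) <= M, which
    dominates 5/2 of either product. *)
Lemma bound_same_vertex A B C M : balanced A B C M ->
  pointing A.1 B.1 C.1 -> pointing A.2 B.2 C.2 ->
  5 / 2 * `|cross A B| <= M.
Proof.
case: A B C => [x1 y1] [x2 y2] [x3 y3].
rewrite /balanced /pointing /cross /= !ler_norml.
move=> [[sx sy] [bx1 bx2 bx3] [by1 by2 by3]].
move=> [/add_norm_le[e1 e2 e3 e4] /add_norm_le[f1 f2 f3 f4]].
move=> /add_norm_le[g1 g2 g3 g4] [hx1 hx2 hx3] [hy1 hy2 hy3].
have E : x1 * y2 - y1 * x2 = x2 * y3 - x3 * y2.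
  have -> : x1 = - x2 - x3 by lra.
  have -> : y1 = - y2 - y3 by lra.
  by ring.
rewrite E.
have H (b r : R) : 0 <= b <= 1 -> 0 <= r <= 1 -> 5 / 2 * (b * r) <= 3 / 2 * (b + r).
  by move=> ? ?; nra.
have H1 := H x2 y3; have H2 := H x3 y2.
have P1 : 0 <= x2 * y3 by exact: mulr_ge0.
have P2 : 0 <= x3 * y2 by exact: mulr_ge0.
have {H1} : 5 / 2 * (x2 * y3) <= M by apply: (le_trans (H1 _ _)); lra.
have {H2} : 5 / 2 * (x3 * y2) <= M by apply: (le_trans (H2 _ _)); lra.
have : 0 <= M by lra.
by case: (lerP 0 (x2 * y3 - x3 * y2)) => [/ger0_norm ->|/ltr0_norm ->]; lra.
Qed.

(** With [b = x2 / a] and [q = y1 / p], the cross product is a p (1 - b q), and the edges have norms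
    a (1 + b) + p (1 + q), a (2 - b) + p |1 - 2 q| and a |1 - 2 b| + p (2 - q). *)
Lemma bound_distinct_vertices A B C M : balanced A B C M ->
  pointing A.1 B.1 C.1 -> pointing B.2 A.2 C.2 ->
  5 / 2 * `|cross A B| <= M.
Proof.
case: A B C => [x1 y1] [x2 y2] [x3 y3].
rewrite /balanced /pointing /cross /= !ler_norml.
move=> [[sx sy] [bx1 bx2 bx3] [by1 by2 by3]].
move=> [/add_norm_le[e1 e2 e3 e4] /add_norm_le[f1 f2 f3 f4]].
move=> /add_norm_le[g1 g2 g3 g4] [hx1 hx2 hx3] [hy2 hy1 hy3].
pose a := - x1; pose p := - y2.
have x2a : x2 <= a by rewrite /a; lra.
have y1p : y1 <= p by rewrite /p; lra.
have -> : x1 * y2 - y1 * x2 = a * p - y1 * x2 by rewrite /a /p; ring.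
have a0 : 0 <= a by rewrite /a; lra.
have p0 : 0 <= p by rewrite /p; lra.
rewrite ger0_norm; last by rewrite subr_ge0 mulrC ler_pM.
have [ap0|ap0] := eqVneq (a * p) 0.
  have := mulr_ge0 hy1 hx2; rewrite ap0; lra.
have [an0 pn0] : a != 0 /\ p != 0.
  by move: ap0; rewrite mulf_eq0 negb_or => /andP[].
have agt0 : 0 < a by rewrite lt_def an0.
have pgt0 : 0 < p by rewrite lt_def pn0.
have b0 : 0 <= x2 / a by rewrite divr_ge0.
have q0 : 0 <= y1 / p by rewrite divr_ge0.
have a1 : a <= 1 by rewrite /a; lra.
have p1 : p <= 1 by rewrite /p; lra.
(* As [a, p <= 1], [a * p * (X + Y) <= a * X + p * Y] for [X, Y >= 0], so the
   inequality reduces to the case [a = p = 1]. *)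
have red (X Y : R) : 0 <= X -> 0 <= Y -> a * X + p * Y <= M -> X + Y <= M / (a * p).
  move=> X0 Y0 H; rewrite ler_pdivlMr ?mulr_gt0//.
  apply: le_trans H; rewrite mulrDl; apply: lerD.
    rewrite mulrA [X * a]mulrC; apply: ler_piMr => //; exact: mulr_ge0.
  by rewrite mulrCA [p * Y]mulrC; apply: ler_piMl => //; exact: mulr_ge0.
have E1 : a * (x2 / a) = x2 by rewrite mulrCA mulfV// mulr1.
have E2 : p * (y1 / p) = y1 by rewrite mulrCA mulfV// mulr1.
have b1 : x2 / a <= 1 by rewrite ler_pdivrMr// mul1r.
have q1 : y1 / p <= 1 by rewrite ler_pdivrMr// mul1r.
have D1 : a = - x1 by [].
have D2 : p = - y2 by [].
(* [n] is the absolute value of [t], described by linear facts only. *)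
have Z (t : R) : exists2 n, 0 <= n & [/\ t <= n & (n = t \/ n = - t)].
  exists `|t| => //; split; first exact: ler_norm.
  by case: (ger0P t) => _; [left|right].
suff : 5 / 2 * (1 - x2 / a * (y1 / p)) <= M / (a * p).
  rewrite ler_pdivlMr ?mulr_gt0//; congr (_ <= _).
  by field; rewrite an0 pn0.
apply: normalized_bound => //.
- have := red (1 + x2 / a) (1 + y1 / p).
  rewrite !mulrDr E1 E2 => H.
  have := H ltac:(lra) ltac:(lra) ltac:(lra); lra.
- have [n n0 [nt ne]] := Z (1 - 2 * (y1 / p)).
  have E3 : p * n = p - 2 * y1 \/ p * n = 2 * y1 - p.
    by case: ne => ->; [left|right]; rewrite -E2; field.
  have := red (2 - x2 / a) n.
  rewrite mulrBr E1 => H.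
  have := H ltac:(lra) n0 ltac:(case: E3 => ->; lra); lra.
- have [n n0 [nt ne]] := Z (1 - 2 * (x2 / a)).
  have E3 : a * n = a - 2 * x2 \/ a * n = 2 * x2 - a.
    by case: ne => ->; [left|right]; rewrite -E1; field.
  have := red n (2 - y1 / p).
  rewrite mulrBr E2 => H.
  have := H n0 ltac:(lra) ltac:(case: E3 => ->; lra); lra.
Qed.


(** * Symmetries of balanced triangles and reduction to the two cases *)

Lemma balanced_rot A B C M : balanced A B C M ->
  balanced B C A M /\ cross B C = cross A B.
Proof.
move=> [[sx sy] [? ? ?] [? ? ?] [? ? ?]]; split.
  by split=> //; split; lra.
rewrite /cross.
have -> : C.1 = - A.1 - B.1 by lra.
have -> : C.2 = - A.2 - B.2 by lra.
by ring.
Qed.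

Lemma balanced_flip A B C M : balanced A B C M ->
  balanced A C B M /\ `|cross A C| = `|cross A B|.
Proof.
move=> [[sx sy] [? ? ?] [? ? ?] [? ? ?]]; split.
  split=> //; first by split; lra.
  by split; rewrite (distrC _.1) (distrC _.2).
rewrite /cross -normrN.
have -> : C.1 = - A.1 - B.1 by lra.
have -> : C.2 = - A.2 - B.2 by lra.
by congr `|_|; ring.
Qed.

Definition negx (A : R * R) := (- A.1, A.2).
Definition negy (A : R * R) := (A.1, - A.2).

Lemma balanced_negx A B C M : balanced A B C M ->
  balanced (negx A) (negx B) (negx C) M /\
  `|cross (negx A) (negx B)| = `|cross A B|.
Proof.
move=> [[sx sy] [? ? ?] [? ? ?] [? ? ?]]; split.
  split=> //=; rewrite ?normrN //; first by split; lra.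
  by rewrite -!opprD !normrN.
by rewrite /cross /= -normrN; congr `|_|; ring.
Qed.

Lemma balanced_negy A B C M : balanced A B C M ->
  balanced (negy A) (negy B) (negy C) M /\
  `|cross (negy A) (negy B)| = `|cross A B|.
Proof.
move=> [[sx sy] [? ? ?] [? ? ?] [? ? ?]]; split.
  split=> //=; rewrite ?normrN //; first by split; lra.
  by rewrite -!opprD !normrN.
by rewrite /cross /= -normrN; congr `|_|; ring.
Qed.

Definition pointed (x1 x2 x3 : R) :=
  [\/ pointing x1 x2 x3, pointing x2 x3 x1 | pointing x3 x1 x2].

(** Case analysis on signs; three negative numbers cannot have sum 0, and three nonnegative ones all
    vanish. *)
Lemma pointed_or_opp (x1 x2 x3 : R) : x1 + x2 + x3 = 0 ->
  pointed x1 x2 x3 \/ pointed (- x1) (- x2) (- x3).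
Proof.
move=> s; rewrite /pointed /pointing.
case: (lerP 0 x1) => h1; case: (lerP 0 x2) => h2; case: (lerP 0 x3) => h3.
- by left; apply: Or31; split; lra.
- by left; apply: Or33; split; lra.
- by left; apply: Or32; split; lra.
- by right; apply: Or31; split; lra.
- by left; apply: Or31; split; lra.
- by right; apply: Or32; split; lra.
- by right; apply: Or33; split; lra.
- by lra.
Qed.

(** The vertex singled out by the second coordinate is A, B or C; the flip of B and C reduces the
    last case to the second. *)
Lemma bound_pointing A B C M : balanced A B C M ->
  pointing A.1 B.1 C.1 -> pointed A.2 B.2 C.2 -> 5 / 2 * `|cross A B| <= M.
Proof.
move=> bal px [] py.
- exact: bound_same_vertex bal px py.
- have [? ? ?] := py; apply: bound_distinct_vertices bal px _; by split.
- have [bal' <-] := balanced_flip bal.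
  by have [? ? ?] := px; apply: bound_distinct_vertices bal' _ py.
Qed.

Lemma bound_pointed A B C M : balanced A B C M ->
  pointed A.1 B.1 C.1 -> pointed A.2 B.2 C.2 -> 5 / 2 * `|cross A B| <= M.
Proof.
have rot (x1 x2 x3 : R) : pointed x1 x2 x3 -> pointed x2 x3 x1.
  by case=> ?; [exact: Or33|exact: Or31|exact: Or32].
move=> bal px py; have [bal' E'] := balanced_rot bal.
have [bal'' E''] := balanced_rot bal'.
case: px => px.
- exact: bound_pointing bal px py.
- by rewrite -E'; apply: bound_pointing bal' px (rot _ _ _ py).
- by rewrite -E' -E''; apply: bound_pointing bal'' px (rot _ _ _ (rot _ _ _ py)).
Qed.

Lemma balanced_bound A B C M : balanced A B C M -> 5 / 2 * `|cross A B| <= M.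
Proof.
wlog px : A B C / pointed A.1 B.1 C.1 => [H|] bal.
  have [[sx _] _ _ _] := bal.
  have [px|px] := pointed_or_opp sx; first exact: (H A B C).
  by have [bal' <-] := balanced_negx bal; exact: H bal'.
have [[_ sy] _ _ _] := bal.
have [py|py] := pointed_or_opp sy; first exact: bound_pointed bal px py.
by have [bal' <-] := balanced_negy bal; exact: bound_pointed bal' px py.
Qed.

End LowerBound.

(** * The square and the simplex *)

Section BaseShapes.
Variable R : realType.
Notation M := (measurableTypeR R).
Notation leb := (@lebesgue_measure R).
Notation mu := ((leb \x leb)%E).

Definition simplex2 : set (R * R) :=
  [set x | [/\ 0 <= x.1, 0 <= x.2 & x.1 + x.2 <= 1]].

Definition cube2 : set (R * R) := [set x | -1 <= x.1 <= 1 /\ -1 <= x.2 <= 1].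

Lemma cube2E : cube2 = square 1.
Proof.
by apply/seteqP; split => -[x y]; rewrite /cube2 /square /= !in_itv /=.
Qed.

Lemma square_gt0 (a b : R) : a < b ->
  (0 < mu (`[a, b]%classic `*` `[a, b]%classic))%E.
Proof.
move=> ab; rewrite product_measure1E; [|exact: measurable_itv..].
have H : (0 < leb (`[a, b]%classic : set R))%E.
  by rewrite lebesgue_measure_itv /= lte_fin ab -EFinB lte_fin subr_gt0.
by rewrite mule_gt0.
Qed.

Lemma body_cube2 : body cube2.
Proof.
rewrite cube2E; split.
- by apply: measurableX; exact: measurable_itv.
- by exists 1.
- by apply: square_gt0; lra.
Qed.

Lemma body_simplex2 : body simplex2.
Proof.
have mS : measurable (simplex2 : set (M * M)).
  have -> : simplex2 = (fst @^-1` `[0, +oo[) `&` (snd @^-1` `[0, +oo[) `&`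
      ((fun x : R * R => x.1 + x.2) @^-1` `]-oo, 1]).
    apply/seteqP; split => -[x y]; rewrite /simplex2 /= !in_itv /= !andbT.
      by case=> *; split.
    by case=> -[].
  have m12 : measurable_fun [set: M * M] (fun x : M * M => x.1 + x.2 : M).
    by apply: measurable_funD; [exact: measurable_fst|exact: measurable_snd].
  apply: measurableI; first apply: measurableI.
  - rewrite -[X in measurable X]setTI.
    by apply: measurable_fst => //; exact: measurable_itv.
  - rewrite -[X in measurable X]setTI.
    by apply: measurable_snd => //; exact: measurable_itv.
  - rewrite -[X in measurable X]setTI.
    by apply: m12 => //; exact: measurable_itv.
split=> //.
- exists 1 => -[x y] [/= x0 y0 xy].
  by rewrite /square /= !in_itv /=; split; apply/andP; split; lra.
(* The simplex contains the square [0, 1/2]^2, which has positive area. *)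
- apply: (@lt_le_trans _ _ (mu (`[0, 1 / 2]%classic `*` `[0, 1 / 2]%classic))).
    by apply: square_gt0; lra.
  apply: le_measure; rewrite ?inE//.
    by apply: measurableX; exact: measurable_itv.
  by move=> [x y]; rewrite /simplex2 /= !in_itv /= => -[/andP[? ?] /andP[? ?]]; split; lra.
Qed.

(** The square is invariant under the central symmetry [g], whose only fixed point is the origin. *)
Lemma centroid_cube2 : centroid cube2 = (0, 0).
Proof.
pose g (x : R * R) := (-1 * x.1 + 0 * x.2 + 0, 0 * x.1 + -1 * x.2 + 0).
have ag : nondeg_affine g.
  by exists (-1), 0, 0, (-1), 0, 0; split=> //; apply/eqP => ?; lra.
have gE : g @` cube2 = cube2.
  apply/seteqP; split => [_ [[x y] [/= hx hy] <-]|[x y] [/= hx hy]].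
    by rewrite /cube2 /g /=; split; lra.
  by exists (- x, - y); rewrite /cube2 /g /=; [split; lra|congr pair; ring].
have := centroid_affine ag body_cube2; rewrite gE.
case: (centroid cube2) => x y [hx hy]; congr pair; lra.
Qed.

(* The affine map [g] permutes the vertices cyclically, so it fixes the centroid. *)
Lemma centroid_simplex2 : centroid simplex2 = (1 / 3, 1 / 3).
Proof.
pose g (x : R * R) := (0 * x.1 + 1 * x.2 + 0, -1 * x.1 + -1 * x.2 + 1).
have ag : nondeg_affine g.
  by exists 0, 1, (-1), (-1), 0, 1; split=> //; apply/eqP => ?; lra.
have gE : g @` simplex2 = simplex2.
  apply/seteqP; split => [_ [[x y] [/= hx hy hxy] <-]|[x y] [/= hx hy hxy]].
    by rewrite /simplex2 /g /=; split; lra.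
  exists (1 - x - y, x); rewrite /simplex2 /g /=; first by split; lra.
  by congr pair; ring.
have := centroid_affine ag body_simplex2; rewrite gE.
case: (centroid simplex2) => x y [hx hy]; congr pair; lra.
Qed.

(** The parameters are s = (1 + x) / 2 and t = (1 + y) / 2, so the origin goes to the centre of the
    parallelogram. *)
Lemma parallelogramE (P : set (R * R)) : parallelogram P ->
  exists2 f, nondeg_affine f & P = f @` cube2.
Proof.
move=> [p [u [v [D0 ->]]]].
exists (fun x => (u.1 / 2 * x.1 + v.1 / 2 * x.2 + (p.1 + (u.1 + v.1) / 2),
                  u.2 / 2 * x.1 + v.2 / 2 * x.2 + (p.2 + (u.2 + v.2) / 2))).
  do 6! eexists; split; last by [].
  have -> : u.1 / 2 * (v.2 / 2) - v.1 / 2 * (u.2 / 2) =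
            (u.1 * v.2 - u.2 * v.1) / 4 by field.
  by rewrite mulf_neq0 ?invr_eq0 ?pnatr_eq0.
apply/seteqP; split => [_ [s [t [/andP[s0 s1] /andP[t0 t1] ->]]]|_ [[x y] [/= hx hy] <-]] /=.
  exists (2 * s - 1, 2 * t - 1); first by rewrite /cube2 /=; split; lra.
  by congr pair => /=; field.
exists ((1 + x) / 2), ((1 + y) / 2); split; [lra|lra|].
by congr pair => /=; field.
Qed.

Lemma triangleE (T : set (R * R)) : triangle T ->
  exists2 f, nondeg_affine f & T = f @` simplex2.
Proof.
move=> [p [u [v [D0 ->]]]].
exists (fun x => (u.1 * x.1 + v.1 * x.2 + p.1, u.2 * x.1 + v.2 * x.2 + p.2)).
  do 6! eexists; split; last by [].
  by rewrite [v.1 * _]mulrC.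
apply/seteqP; split => [_ [s [t [s0 t0 st ->]]]|_ [[s t] [/= s0 t0 st] <-]] /=.
  exists (s, t) => //; by congr pair => /=; ring.
by exists s, t; split=> //; congr pair; ring.
Qed.

Lemma nondeg_affine_comp (f g : R * R -> R * R) :
  nondeg_affine f -> nondeg_affine g -> nondeg_affine (f \o g).
Proof.
move=> [a [b [c [d [e [h [D0 fE]]]]]]] [a' [b' [c' [d' [e' [h' [D0' gE]]]]]]].
exists (a * a' + b * c'), (a * b' + b * d'), (c * a' + d * c'), (c * b' + d * d'),
  (a * e' + b * h' + e), (c * e' + d * h' + h); split.
  have -> : (a * a' + b * c') * (c * b' + d * d') -
     (a * b' + b * d') * (c * a' + d * c') =
     (a * d - b * c) * (a' * d' - b' * c') by ring.
  by rewrite mulf_neq0.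
by move=> x; rewrite /= fE gE /=; congr pair; ring.
Qed.

Lemma affine_homothety (f : R * R -> R * R) z l x : nondeg_affine f ->
  f (homothety z l x) = homothety (f z) l (f x).
Proof.
move=> [a [b [c [d [e [h [_ fE]]]]]]].
by rewrite /homothety !fE /=; congr pair; ring.
Qed.

End BaseShapes.

(** * The optimal ratio for the square and the simplex *)

Section Assembly.
Variable R : realType.

Lemma extreme_point_cube2 (u v : R) : exists2 x : R * R,
  cube2 x & x.1 * u + x.2 * v = `|u| + `|v|.
Proof.
have sg (t : R) : exists2 s : R, -1 <= s <= 1 & s * t = `|t|.
  case: (ger0P t) => _; [exists 1; last by rewrite mul1r|
                         exists (-1); last by rewrite mulN1r]; lra.
have [s sb sE] := sg u; have [t tb tE] := sg v.
by exists (s, t) => //=; rewrite sE tE.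
Qed.

(** The maximum over the square of the linear form x |-> x x w is the l^1 norm of [w], attained at a
    vertex. *)
Lemma edge_le_cross (w : R * R) (X : set (R * R)) (k : R) :
  @cube2 R `<=` X -> (forall x, X x -> cross x w <= k) -> `|w.1| + `|w.2| <= k.
Proof.
move=> cX Xk; have [x cx xE] := extreme_point_cube2 w.2 (- w.1).
have := Xk x (cX _ cx); rewrite /cross -mulrN xE normrN; lra.
Qed.

(** Each edge of the dilated triangle bounds a half-plane containing the square, which limits the
    l^1 norm of that edge to l |A x B|; [balanced_bound] then applies. *)
Lemma dilation_ge (k : R * R -> R * R) (l : R) : nondeg_affine k ->
  k @` (@simplex2 R) `<=` @cube2 R -> k (1 / 3, 1 / 3) = (0, 0) -> 1 <= l ->
  @cube2 R `<=` homothety (0, 0) l @` (k @` (@simplex2 R)) -> 5 / 2 <= l.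
Proof.
move=> [a [b [c [d [e [g [D0 kE]]]]]]] kc k0 l1 ck.
pose A := k (0, 0); pose B := k (1, 0); pose C := k (0, 1).
have k0' : (a * (1 / 3) + b * (1 / 3) + e = 0) /\
           (c * (1 / 3) + d * (1 / 3) + g = 0).
  by move: k0; rewrite kE /= => -[].
have [e0 g0] := k0'.
have vA : cube2 A by apply: kc; exists (0, 0) => //; rewrite /simplex2 /=; split; lra.
have vB : cube2 B by apply: kc; exists (1, 0) => //; rewrite /simplex2 /=; split; lra.
have vC : cube2 C by apply: kc; exists (0, 1) => //; rewrite /simplex2 /=; split; lra.
have K3 : 3 * cross A B = a * d - b * c.
  rewrite /cross /A /B !kE /=.
  have -> : e = - (a * (1 / 3) + b * (1 / 3)) by lra.
  have -> : g = - (c * (1 / 3) + d * (1 / 3)) by lra.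
  by field.
have K0 : cross A B != 0 by apply: contra_neq D0 => KE; rewrite -K3 KE mulr0.
pose X := homothety (0, 0) l @` (k @` (@simplex2 R)).
have bal : balanced A B C (l * `|cross A B|).
  pose s : R := Num.sg (cross A B).
  have sE : s * cross A B = `|cross A B| by rewrite /s normrEsg.
  have edge (U V : R * R) :
      (forall y, simplex2 y -> s * cross (k y) (V.1 - U.1, V.2 - U.2) <=
         `|cross A B|) ->
      `|U.1 - V.1| + `|U.2 - V.2| <= l * `|cross A B|.
    move=> H.
    have Hs : `|s| = 1 by rewrite /s normr_sg K0.
    have := @edge_le_cross (s * (V.1 - U.1), s * (V.2 - U.2)) X (l * `|cross A B|) ck.
    rewrite /= !normrM Hs !mul1r (distrC V.1) (distrC V.2); apply.
    move=> _ [_ [y sy <-] <-].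
    have -> : cross (homothety (0, 0) l (k y)) (s * (V.1 - U.1), s * (V.2 - U.2)) =
              l * (s * cross (k y) (V.1 - U.1, V.2 - U.2)).
      by rewrite /cross /homothety /=; ring.
    by apply: ler_wpM2l; [lra|exact: H].
  (* [t] will be the barycentric coordinate of [k y] at the vertex opposite the edge [W]; the factor
     [1 - 3 * t] is 1 on the edge and -2 at that vertex. *)
  have cr (y W : R * R) (t : R) : 0 <= t ->
      cross (k y) W = (1 - 3 * t) * cross A B -> s * cross (k y) W <= `|cross A B|.
    move=> t0 ->; rewrite mulrCA sE; have := normr_ge0 (cross A B); nra.
  have eE : e = - (a * (1 / 3) + b * (1 / 3)) by lra.
  have gE : g = - (c * (1 / 3) + d * (1 / 3)) by lra.
  split.
  - by split; rewrite /A /B /C !kE /=; lra.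
  - by split; rewrite ler_norml; case: vA vB vC => [? ?] [? ?] [? ?].
  - by split; rewrite ler_norml; case: vA vB vC => [? ?] [? ?] [? ?].
  - split; apply: edge => y [y1 y2 y12].
    + apply: (cr _ _ y.2) => //.
      by rewrite /cross /A /B !kE /= eE gE; field.
    + apply: (cr _ _ (1 - y.1 - y.2)); first by lra.
      by rewrite /cross /A /B /C !kE /= eE gE; field.
    + apply: (cr _ _ y.1) => //.
      by rewrite /cross /A /B /C !kE /= eE gE; field.
have := balanced_bound bal.
by rewrite ler_pM2r // normr_gt0.
Qed.

(* The image triangle has vertices (-1, 0), (1/2, 1), (1/2, -1). *)
Lemma dilation_attained : exists k : R * R -> R * R,
  [/\ nondeg_affine k, k @` (@simplex2 R) `<=` @cube2 R,
      k (1 / 3, 1 / 3) = (0, 0) &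
      @cube2 R `<=` homothety (0, 0) (5 / 2) @` (k @` (@simplex2 R))].
Proof.
exists (fun x => (3 / 2 * x.1 + 3 / 2 * x.2 + -1, 1 * x.1 + -1 * x.2 + 0)); split.
- exists (3 / 2), (3 / 2), 1, (-1), (-1), 0; split=> //; apply/eqP => ?; lra.
- by move=> _ [[s t] [/= s0 t0 st] <-]; rewrite /cube2 /=; split; lra.
- by congr pair => /=; field.
- move=> [x y] [/= hx hy].
  (* The solution of 3/2 (s + t) - 1 = 2/5 x and s - t = 2/5 y. *)
  pose s := (2 / 5 * x + 1) / 3 + y / 5; pose t := (2 / 5 * x + 1) / 3 - y / 5.
  exists (3 / 2 * s + 3 / 2 * t + -1, 1 * s + -1 * t + 0).
    by exists (s, t) => //; rewrite /simplex2 /s /t /=; split; lra.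
  by rewrite /homothety /s /t /=; congr pair; field.
Qed.

End Assembly.

Theorem mainTheorem1 (R : realType) (P T : set (R * R)) :
  parallelogram P -> triangle T -> cenBM P T = 5 / 2.
Proof.
move=> /parallelogramE[F aF PE] /triangleE[G aG TE].
have [F' aF' [FK F'K]] := nondeg_affine_inv aF.
have [G' aG' [GK G'K]] := nondeg_affine_inv aG.
have cP : centroid P = F (0, 0).
  by rewrite PE (centroid_affine aF (body_cube2 R)) centroid_cube2.
have cfT f : nondeg_affine f -> centroid (f @` T) = f (G (1 / 3, 1 / 3)).
  move=> af; rewrite TE image_comp.
  by rewrite (centroid_affine (nondeg_affine_comp af aG) (body_simplex2 R))
    centroid_simplex2.
rewrite /cenBM; set S := (X in inf X).
have S_ge l : S l -> 5 / 2 <= l.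
  move=> [l1 [f [af fT Pf cf]]].
  (* Conjugation by [F] and [G] carries a competitor for [P] and [T] to one for the square and the
     simplex with the same ratio, as affine maps commute with homotheties. *)
  have ak : nondeg_affine (F' \o (f \o G)).
    by apply: nondeg_affine_comp => //; exact: nondeg_affine_comp.
  have k0 : F' (f (G (1 / 3, 1 / 3))) = (0, 0) by rewrite -cfT// cf cP FK.
  apply: (dilation_ge ak) => //.
  - move=> _ [y sy <-] /=.
    have : P (f (G y)) by apply: fT; exists (G y) => //; rewrite TE; exists y.
    by rewrite PE => -[x cx <-]; rewrite FK.
  - move=> x cx.
    have /Pf[_ [w Tw <-] E] : P (F x) by rewrite PE; exists x.
    rewrite cf cP in E; move: Tw E; rewrite TE => -[y sy <-] E.
    exists (F' (f (G y))); first by exists y.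
    by rewrite -{1}(FK (0, 0)) -affine_homothety// E FK.
have S_mem : S (5 / 2).
  have [k [ak kc k0 ck]] := dilation_attained R.
  split; first by lra.
  have af : nondeg_affine (F \o (k \o G')).
    by apply: nondeg_affine_comp => //; exact: nondeg_affine_comp.
  have cf : centroid ((F \o (k \o G')) @` T) = F (0, 0).
    by rewrite cfT//= GK k0.
  exists (F \o (k \o G')); split=> //; last by rewrite cf cP.
  - move=> _ [w Tw <-]; move: Tw; rewrite TE => -[y sy <-] /=.
    by rewrite GK PE; exists (k y) => //; apply: kc; exists y.
  - rewrite cf PE => _ [x /ck[_ [y sy <-] <-] <-].
    exists (F (k y)); last by rewrite affine_homothety.
    by exists (G y); rewrite ?TE /= ?GK//; exists y.
(* The infimum is a minimum: 5/2 serves first as the lower bound required by [ge_inf], then as the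
   element showing that [S] is nonempty. *)
apply/eqP; rewrite eq_le; apply/andP; split.
  by apply: ge_inf => //; exists (5 / 2).
by apply: lb_le_inf => //; exists (5 / 2).
Qed.
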